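(* Let $p$ be an odd prime, $r\ge1$, $N:=p^r$, $u:=\varepsilon(i)\in\mathcal H$, and put $\eta:=i(i^{-N}-1)\in S_r$. Then: (i) $\eta=1-i$ if $N\equiv1\pmod 4$ and $\eta=-1-i$ if $N\equiv3\pmod4$; in particular $\eta\in S_r^\times$; (ii) setting $H_0:=(1+i^{-N})\eta^{-1}$ and $H_k:=2i^{-k}\eta^{-1}$ for $1\le k\le N-1$, one has $H_0=1$ if $N\equiv1\pmod4$, $H_0=-1$ if $N\equiv3\pmod4$, and $H_k\in S_r^\times$ for all $0\le k\le N-1$; (iii) $F=\sum_{k=0}^{N-1}H_ku^k$ in $\mathcal H$; (iv) $F_n=\sum_{1\le k\le N-1,\ p\nmid k}H_k(ki)^n$ for every $n\ge r$.
   Context: $E_n$ ($n\ge0$) are the Euler up/down numbers, the integers determined by $\sum_{n\ge0}E_n z^n/n!=\sec z+\tan z$. $S_r:=(\mathbb Z/p^r\mathbb Z)[x]/(x^2+1)$, and $i\in S_r$ is the class of $x$, so $i^2=-1$, and $i$ is a unit with $i^{-1}=-i$. For a commutative ring $A$ with identity, $A\langle z\rangle$ denotes the ring of Hurwitz series over $A$: all sequences $a=(a_n)_{n\ge0}$ in $A$ (written formally $\sum_n a_n z^n/n!$), with coefficientwise addition and product $(ab)_n=\sum_{k=0}^n\binom nk a_kb_{n-k}$; its identity is $(1,0,0,\dots)$. Write $\mathcal H:=S_r\langle z\rangle$; an element $\xi\in S_r$ is identified with the constant series $(\xi,0,0,\dots)\in\mathcal H$. For $\alpha\in S_r$, $\varepsilon(\alpha):=(1,\alpha,\alpha^2,\alpha^3,\dots)\in\mathcal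 H$. $F=(F_n)_{n\ge0}\in\mathcal H$ is the Hurwitz series whose $n$-th coefficient $F_n$ is the image of the integer $E_n$ in $S_r$. Convention: $\alpha^0=1$ for every ring element $\alpha$, including $0^0=1$. *)

(* Defs.v *)
From HB Require Import structures.
From mathcomp Require Import all_boot all_order all_algebra.
From mathcomp Require Import boolp.

Set Implicit Arguments.
Unset Strict Implicit.
Unset Printing Implicit Defensive.

Import GRing.Theory.
Local Open Scope ring_scope.

(** * Hurwitz series *)

(* [Hurwitz a] is the formal series \sum_n a_n z^n / n!. *)
Record hurwitz (A : Type) := Hurwitz { hcoef :> nat -> A }.

Notation "[ 'hurwitz' n => E ]" := (Hurwitz (fun n : nat => E))
  (at level 0, n name, format "[ 'hurwitz'  n  =>  E ]") : ring_scope.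

HB.instance Definition _ (A : Type) := gen_eqMixin (hurwitz A).
HB.instance Definition _ (A : Type) := gen_choiceMixin (hurwitz A).

Lemma hurwitzP (A : Type) (a b : hurwitz A) : (forall n, a n = b n) -> a = b.
Proof. by case: a b => [a] [b] ab; congr Hurwitz; apply/funext. Qed.

Section HurwitzZmodule.
Variable A : zmodType.
Implicit Types a b c : hurwitz A.

Definition hzero : hurwitz A := [hurwitz n => 0].
Definition hopp a : hurwitz A := [hurwitz n => - a n].
Definition hadd a b : hurwitz A := [hurwitz n => a n + b n].

Fact haddA : associative hadd.
Proof. by move=> a b c; apply: hurwitzP => n; apply: addrA. Qed.
Fact haddC : commutative hadd.
Proof. by move=> a b; apply: hurwitzP => n; apply: addrC. Qed.
Fact hadd0 : left_id hzero hadd.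
Proof. by move=> a; apply: hurwitzP => n; apply: add0r. Qed.
Fact haddN : left_inverse hzero hopp hadd.
Proof. by move=> a; apply: hurwitzP => n; apply: addNr. Qed.

HB.instance Definition _ :=
  GRing.isZmodule.Build (hurwitz A) haddA haddC hadd0 haddN.
End HurwitzZmodule.

Section HurwitzComPzRing.
Variable A : comPzRingType.
Implicit Types a b c : hurwitz A.

Definition hconst (x : A) : hurwitz A := [hurwitz n => if n == 0%N then x else 0].
Definition hmul a b : hurwitz A :=
  [hurwitz n => \sum_(k < n.+1) a k * b (n - k)%N *+ 'C(n, k)].

(* The derivative d/dz; it reduces associativity of [hmul] to Leibniz' rule. *)
Definition hderiv a : hurwitz A := [hurwitz n => a n.+1].

Fact hmulC : commutative hmul.
Proof.
move=> a b; apply: hurwitzP => n /=; rewrite (reindex_inj rev_ord_inj) /=.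
apply: eq_bigr => k _; have kn : (k <= n)%N by rewrite -ltnS.
by rewrite subSS subKn // bin_sub // mulrC.
Qed.

Fact hmulDl : left_distributive hmul +%R.
Proof.
move=> a b c; apply: hurwitzP => n /=.
by rewrite -big_split; apply: eq_bigr => k _ /=; rewrite mulrDl mulrnDl.
Qed.

Fact hmul1 : left_id (hconst 1) hmul.
Proof.
move=> a; apply: hurwitzP => n /=; rewrite big_ord_recl /= mul1r subn0 bin0.
by rewrite big1 ?addr0 // => k _; rewrite mul0r mul0rn.
Qed.

Fact hderivM a b : hderiv (hmul a b) = hmul (hderiv a) b + hmul a (hderiv b).
Proof.
apply: hurwitzP => n /=; rewrite big_ord_recl /= bin0 subn0.
under eq_bigr => k _ do rewrite /bump /= add1n binS mulrnDr subSS.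
rewrite big_split /= addrA addrC; congr (_ + _).
rewrite big_ord_recr /= bin_small // mulr0n addr0 [RHS]big_ord_recl /= bin0 subn0.
congr (_ + _); apply: eq_bigr => k _; rewrite /bump /= add1n.
by rewrite -subSn // subSS.
Qed.

Fact hmulA : associative hmul.
Proof.
move=> a b c; apply: hurwitzP => n; elim: n => [|n IHn] in a b c *.
  have h0 x y : hmul x y 0%N = x 0%N * y 0%N by rewrite /= big_ord1 bin0.
  by rewrite !h0 mulrA.
have hmulDr x y z : hmul x (y + z) = hmul x y + hmul x z.
  by rewrite ![hmul x _]hmulC hmulDl.
have hS (x : hurwitz A) : x n.+1 = hderiv x n by [].
rewrite !hS !hderivM hmulDr hmulDl.
have hD (x y : hurwitz A) m : (x + y) m = x m + y m by [].
by rewrite !hD !IHn addrA.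
Qed.

HB.instance Definition _ := GRing.Zmodule_isComPzRing.Build (hurwitz A)
  hmulA hmulC hmul1 hmulDl.

Lemma hcoef0M a b : (a * b) 0%N = a 0%N * b 0%N.
Proof. by rewrite /= big_ord1 bin0. Qed.

(* The exponential series exp (x z). *)
Definition heps (x : A) : hurwitz A := [hurwitz n => x ^+ n].
End HurwitzComPzRing.

Fact hone_neq0 (A : comNzRingType) : (1 : hurwitz A) != 0.
Proof.
by apply/eqP => /(congr1 (fun a : hurwitz A => a 0%N)) /eqP; rewrite /= oner_eq0.
Qed.

HB.instance Definition _ (A : comNzRingType) :=
  GRing.PzSemiRing_isNonZero.Build (hurwitz A) (@hone_neq0 A).

Section HurwitzUnit.
Variable A : comUnitRingType.
Implicit Types a b : hurwitz A.

(* The coefficients of index 0, ..., n of the inverse of [a]. *)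
Fixpoint hinv_seq a (n : nat) : seq A :=
  if n is m.+1 then
    let s := hinv_seq a m in
    rcons s (- (a 0%N)^-1 * \sum_(k < n) a k.+1 * s`_(m - k) *+ 'C(n, k.+1))
  else [:: (a 0%N)^-1].

Definition hunit : pred (hurwitz A) := fun a => a 0%N \is a GRing.unit.
Definition hinv a : hurwitz A :=
  if hunit a then [hurwitz n => (hinv_seq a n)`_n] else a.

Fact size_hinv_seq a n : size (hinv_seq a n) = n.+1.
Proof. by elim: n => //= n IHn; rewrite size_rcons IHn. Qed.

Fact nth_hinv_seq a m n : (m <= n)%N -> (hinv_seq a n)`_m = (hinv_seq a m)`_m.
Proof.
elim: n => [|n IHn]; first by rewrite leqn0 => /eqP->.
rewrite leq_eqVlt => /predU1P[-> // | mn].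
by rewrite /= nth_rcons size_hinv_seq mn IHn.
Qed.

Fact hmulV : {in hunit, left_inverse 1 hinv *%R}.
Proof.
move=> a ua; have {}ua : hunit a by [].
rewrite mulrC /hinv ua; apply: hurwitzP => -[|n].
  by rewrite hcoef0M /= divrr.
rewrite /= big_ord_recl /= bin0 subn0 nth_rcons size_hinv_seq ltnn eqxx.
rewrite mulNr mulrN mulVKr // addrC.
apply/eqP; rewrite subr_eq0; apply/eqP/eq_bigr => k _.
by rewrite /bump /= add1n subSS (nth_hinv_seq _ (leq_subr k n)).
Qed.

Fact hunitP a b : b * a = 1 -> hunit a.
Proof.
move=> ba1; apply/unitrPr; exists (b 0%N).
by rewrite mulrC -hcoef0M ba1.
Qed.

Fact hinv_out : {in [predC hunit], hinv =1 id}.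
Proof. by move=> a ua; rewrite /hinv ifN. Qed.

HB.instance Definition _ :=
  GRing.ComNzRing_hasMulInverse.Build (hurwitz A) hmulV hunitP hinv_out.
End HurwitzUnit.

(** * Euler up/down numbers *)

Definition hcos : hurwitz int :=
  [hurwitz n => if odd n then 0 else (-1) ^+ n./2].
Definition hsin : hurwitz int :=
  [hurwitz n => if odd n then (-1) ^+ n./2 else 0].

(* sec z + tan z; its n-th coefficient is the Euler up/down number E_n. *)
Definition euler_updown : hurwitz int := hcos^-1 + hsin / hcos.

Fact euler_updownM_cos : euler_updown * hcos = 1 + hsin.
Proof. by rewrite mulrDl mulVr // divrK. Qed.

(** * The ring (Z/p^r)[x]/(x^2 + 1) *)

Section GaussZmod.
Variables p r : nat.

(* If p is prime and 0 < r then 1 < p ^ r, so that 'Z_(p ^ r) is Z/p^r. *)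
Definition gauss_zmod := {poly %/ ('X^2 + 1 : {poly 'Z_(p ^ r)})}.

HB.instance Definition _ := GRing.ComNzRing.on gauss_zmod.
HB.instance Definition _ := Finite.on gauss_zmod.
(* An element of this finite ring is a unit iff it has an inverse, and [_^-1]
   picks the inverse; in general R[x]/(x^2 + 1) has no canonical unit ring
   structure in the library. *)
HB.instance Definition _ := FinRing.isNzRing.Build gauss_zmod.

Definition gauss_i : gauss_zmod := in_qpoly ('X^2 + 1) 'X.

Fact gauss_i_sqr : gauss_i ^+ 2 = -1.
Proof.
have sz : size ('X^2 + 1 : {poly 'Z_(p ^ r)}) = 3%N.
  by rewrite size_polyDl size_polyXn ?size_poly1.
have mon : ('X^2 + 1 : {poly 'Z_(p ^ r)}) \is monic.
  by rewrite monicE lead_coefDl ?lead_coefXn // size_polyXn size_poly1.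
have mkE : mk_monic ('X^2 + 1 : {poly 'Z_(p ^ r)}) = 'X^2 + 1.
  by rewrite /mk_monic sz mon.
apply/eqP; rewrite -addr_eq0; apply/eqP.
rewrite /gauss_i -in_qpoly1 -rmorphXn -rmorphD; apply: val_inj => /=.
by rewrite mkE Pdiv.RingMonic.rmodpp.
Qed.

Fact gauss_iV : gauss_i \is a GRing.unit /\ gauss_i^-1 = - gauss_i.
Proof.
have iN : gauss_i * - gauss_i = 1 by rewrite mulrN -expr2 gauss_i_sqr opprK.
have ui : gauss_i \is a GRing.unit by apply/unitrPr; exists (- gauss_i).
by split=> //; apply: (mulrI ui); rewrite divrr.
Qed.
End GaussZmod.

(* Main.v *)
Require Import Defs.
From HB Require Import structures.
From mathcomp Require Import all_boot all_order all_algebra.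
From mathcomp Require Import ring.
Import GRing.Theory.
Local Open Scope ring_scope.

(** Write exp (x z) for the series [heps x]. Over any commutative ring in which
    i ^ 2 = -1 and 2 is a unit, Euler's formulas 2 cos z = u + u^-1 and
    2 i sin z = u - u^-1, with u = exp (i z), turn the defining relation
    (sec z + tan z) cos z = 1 + sin z into
      F (1 + i u) (u + i) = (u + i) ^ 2.
    The constant term 1 + i of u + i is a unit, so u + i cancels and F becomes
    a homographic function of u: F (1 + i u) = u + i
    ([euler_updown_homography]).

    In addition u ^ N = exp (N i z) = 1 as soon as N = 0 in the ring. With
    v = u / i this says that v ^ N = i ^ -N is a constant, and the telescoping
    identity
      (1 - v) (1 + v ^ N + 2 (v + ... + v ^ (N - 1))) = (1 + v) (1 - v ^ N)
    ([half_geometric_sum]) inverts 1 + i u = 1 - v, whose constant term 1 + i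
    is a unit: since eta i = 1 - i ^ -N, it shows that F is the
    polynomial (1 + v ^ N + 2 (v + ... + v ^ (N - 1))) / eta in u, where
    eta = i (i ^ -N - 1). This is the expansion [euler_updown_expansion], and
    its coefficients are the H k.

    As N is odd, i ^ -N is -i or i according to N modulo 4, so that eta and
    H 0 can be written down, and every unit statement reduces to
    (1 + i) (1 - i) = 2. Finally u ^ k = exp (k i z) has n-th coefficient
    (k i) ^ n; when N = p ^ r and n >= r, this vanishes for every k divisible
    by p, and only the k prime to p survive. *)

(** * Hurwitz series *)

Lemma hurwitz_coef_sum (A : comPzRingType) (I : Type) (s : seq I) (P : pred I)
    (G : I -> hurwitz A) (n : nat) :
  (\sum_(k <- s | P k) G k) n = \sum_(k <- s | P k) G k n.
Proof. exact: (big_morph (fun a : hurwitz A => a n)). Qed.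

Lemma hconstM_coef (A : comPzRingType) (x : A) (a : hurwitz A) (n : nat) :
  (hconst x * a) n = x * a n.
Proof.
rewrite /= big_ord_recl /= subn0 bin0 big1 ?addr0 // => k _.
by rewrite mul0r mul0rn.
Qed.

Fact hconst_zmod_morphism (A : comPzRingType) : zmod_morphism (@hconst A).
Proof.
move=> x y; apply: hurwitzP => -[|n] //=.
by rewrite subr0.
Qed.

Fact hconst_monoid_morphism (A : comPzRingType) : monoid_morphism (@hconst A).
Proof.
split=> // x y; apply: hurwitzP => n; rewrite hconstM_coef.
by case: n => //= n; rewrite mulr0.
Qed.

HB.instance Definition _ (A : comPzRingType) :=
  GRing.isZmodMorphism.Build A (hurwitz A) (@hconst A)
    (@hconst_zmod_morphism A).
HB.instance Definition _ (A : comPzRingType) :=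
  GRing.isMonoidMorphism.Build A (hurwitz A) (@hconst A)
    (@hconst_monoid_morphism A).

(** The binomial theorem is the functional equation of the exponential. *)
Lemma hepsD (A : comPzRingType) (x y : A) : heps (x + y) = heps x * heps y.
Proof.
apply: hurwitzP => n /=; rewrite addrC exprDn.
by apply: eq_bigr => k _; rewrite mulrC.
Qed.

Lemma heps0 (A : comPzRingType) : heps (0 : A) = 1.
Proof. by apply: hurwitzP => n /=; rewrite expr0n; case: n. Qed.

Lemma hepsX (A : comPzRingType) (x : A) (k : nat) :
  heps x ^+ k = heps (k%:R * x).
Proof.
elim: k => [|k IHk]; first by rewrite mul0r heps0.
by rewrite exprS IHk -hepsD -[in RHS]add1n natrD mulrDl mul1r.
Qed.

Definition hint (A : comPzRingType) (a : hurwitz int) : hurwitz A :=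
  [hurwitz n => (a n)%:~R].

Lemma hintM (A : comPzRingType) (a b : hurwitz int) :
  hint A (a * b) = hint A a * hint A b.
Proof.
apply: hurwitzP => n /=; rewrite rmorph_sum; apply: eq_bigr => k _ /=.
by rewrite rmorphMn rmorphM.
Qed.

Lemma hintD (A : comPzRingType) (a b : hurwitz int) :
  hint A (a + b) = hint A a + hint A b.
Proof. by apply: hurwitzP => n /=; rewrite rmorphD. Qed.

Lemma hint1 (A : comPzRingType) : hint A 1 = 1.
Proof. by apply: hurwitzP => -[]. Qed.

(** * Trigonometric series over a ring with a square root of -1 *)

Lemma sqrtN1_expr (A : comPzRingType) (i : A) (n : nat) : i ^+ 2 = -1 ->
  i ^+ n = (if odd n then i else 1) * (-1) ^+ n./2.
Proof.
move=> i2; rewrite -{1}(odd_double_half n) exprD -mul2n exprM i2.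
by case: (odd n).
Qed.

Lemma hcos_heps (A : comPzRingType) (i : A) : i ^+ 2 = -1 ->
  hint A hcos *+ 2 = heps i + heps (- i).
Proof.
move=> i2; rewrite mulr2n; apply: hurwitzP => n /=.
have Ni2 : (- i) ^+ 2 = -1 by rewrite sqrrN.
rewrite (sqrtN1_expr _ _ _ i2) (sqrtN1_expr _ _ _ Ni2).
by case: (odd n); rewrite ?mulNr ?subrr ?addr0 // !mul1r !rmorphXn rmorphN1.
Qed.

Lemma hsin_heps (A : comPzRingType) (i : A) : i ^+ 2 = -1 ->
  hconst i * hint A hsin *+ 2 = heps i - heps (- i).
Proof.
move=> i2; rewrite mulr2n; apply: hurwitzP => n.
have Ni2 : (- i) ^+ 2 = -1 by rewrite sqrrN.
have -> (a b : hurwitz A) : (a + b) n = a n + b n by [].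
rewrite hconstM_coef /= (sqrtN1_expr _ _ _ i2) (sqrtN1_expr _ _ _ Ni2).
case: (odd n); rewrite ?rmorphXn ?rmorphN1 ?mulNr ?opprK //.
by rewrite mulr0 addr0 subrr.
Qed.

Lemma sqrtN1_unit (A : comUnitRingType) (i : A) : i ^+ 2 = -1 ->
  i \is a GRing.unit /\ i^-1 = - i.
Proof.
move=> i2.
have iN : i * - i = 1 by rewrite mulrN -expr2 i2 opprK.
have ui : i \is a GRing.unit by apply/unitrPr; exists (- i).
by split=> //; apply: (mulrI ui); rewrite divrr.
Qed.

Lemma add1_sqrtN1_unit (A : comUnitRingType) (i : A) : i ^+ 2 = -1 ->
  (2%:R : A) \is a GRing.unit -> 1 + i \is a GRing.unit.
Proof.
move=> i2 u2.
have : (1 + i) * (1 - i) \is a GRing.unit.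
  have -> // : (1 + i) * (1 - i) = 2%:R.
  transitivity (1 - i ^+ 2); first by ring.
  by rewrite i2; ring.
by rewrite unitrM => /andP[].
Qed.

(** This is the half-angle formula sec z + tan z = (1 + sin z) / cos z
    = tan (z / 2 + pi / 4), written in terms of exp (i z). *)
Lemma euler_updown_homography (A : comUnitRingType) (i : A) : i ^+ 2 = -1 ->
  (2%:R : A) \is a GRing.unit ->
  hint A euler_updown * (1 + hconst i * heps i) = heps i + hconst i.
Proof.
move=> i2 u2.
have /(congr1 (hint A)) := euler_updownM_cos.
rewrite hintM (hintD A 1) hint1.
have I2 : hconst i ^+ 2 = -1 by rewrite -rmorphXn i2 rmorphN1.
have UW : heps i * heps (- i) = 1 by rewrite -hepsD subrr heps0.
have := hcos_heps _ _ i2; have := hsin_heps _ _ i2.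
(* A Hurwitz series is a unit iff its constant term is, here 1 + i. *)
have uI : heps i + hconst i \is a GRing.unit.
  by rewrite unfold_in /= /hunit /= expr0 add1_sqrtN1_unit.
move: (hint A euler_updown) (hint A hcos) (hint A hsin) => F c s.
move: (hconst i) (heps i) (heps (- i)) I2 UW uI => I u w I2 UW uI sE cE E.
apply: (mulIr uI).
(* From here on the identity follows from I ^ 2 = -1, u w = 1, F c = 1 + s,
   2 c = u + w and 2 I s = u - w alone. *)
have -> : F * (1 + I * u) * (u + I)
    = F * (c *+ 2) * u * I.
  rewrite cE; transitivity (F * (u * (1 + I ^+ 2) + I * (u * u) + I)); first by ring.
  rewrite I2; transitivity (F * (I * (u * u) + I * (u * w))); last by ring.
  by rewrite UW; ring.
transitivity (F * c * (u * I) *+ 2); first by ring.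
rewrite E; transitivity (2%:R * u * I + (I * s *+ 2) * u); first by ring.
rewrite sE; transitivity (2%:R * u * I + u * u - u * w); first by ring.
by rewrite UW -I2; ring.
Qed.

(** The factor 1 + v ^ n + 2 (v + ... + v ^ (n - 1)) is (1 + v) S for the
    geometric sum S = 1 + v + ... + v ^ (n - 1), and (1 - v) S telescopes. *)
Lemma half_geometric_sum (B : comPzRingType) (v : B) (n : nat) : (0 < n)%N ->
  (1 - v) * (1 + v ^+ n + \sum_(1 <= k < n) 2%:R * v ^+ k)
  = (1 + v) * (1 - v ^+ n).
Proof.
elim: n => // -[|n] IHn _; first by rewrite big_geq //; ring.
rewrite (exprS v n.+1) big_nat_recr //=; move: (IHn isT).
move: (v ^+ n.+1) (\sum_(1 <= k < n.+1) _) => w S E.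
transitivity ((1 - v) * (1 + w + S) + (1 - v) * (w + v * w)); first by ring.
by rewrite E; ring.
Qed.

(** * The expansion when N = 0 in the ring *)

(** These assumptions isolate what the argument uses of (Z / N)[x] / (x ^ 2 + 1):
    N = 0 with N odd makes 2 invertible, and N = 0 makes exp (i z) an N-th root
    of unity. *)
Section Expansion.
Context (A : comUnitRingType) (i : A) (N : nat).
Hypotheses (i2 : i ^+ 2 = -1) (oddN : odd N) (N0 : N%:R = 0 :> A).

Let eta : A := i * (i ^- N - 1).
Let H (k : nat) : A :=
  if k == 0%N then (1 + i ^- N) * eta^-1 else 2%:R * i ^- k * eta^-1.

(** The inverse of 2 is (N + 1) / 2. *)
Lemma two_unit : (2%:R : A) \is a GRing.unit.
Proof.
apply/unitrPr; exists (N./2.+1)%:R; rewrite -natrM mul2n doubleS.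
by rewrite -[N./2.*2.+2]/(1 + N./2.*2).+1 -[1%N]/(true : nat) -oddN
  odd_double_half -addn1 natrD N0 add0r.
Qed.

Lemma sqrtN1_exprVN1 : (N = 1 %[mod 4])%N -> i ^- N = - i.
Proof.
have [_ iV] := sqrtN1_unit _ _ i2.
move=> N4; rewrite -exprVn iV (divn_eq N 4) N4 exprD mulnC exprM.
by rewrite (exprM _ 2 2) sqrrN i2 sqrrN expr1n expr1n mul1r.
Qed.

Lemma sqrtN1_exprVN3 : (N = 3 %[mod 4])%N -> i ^- N = i.
Proof.
have [_ iV] := sqrtN1_unit _ _ i2.
move=> N4; rewrite -exprVn iV (divn_eq N 4) N4 exprD mulnC exprM.
rewrite (exprM _ 2 2) sqrrN i2 sqrrN expr1n expr1n mul1r.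
by rewrite exprS sqrrN i2 mulrN1 opprK.
Qed.

Lemma odd_mod4 : (N = 1 %[mod 4])%N \/ (N = 3 %[mod 4])%N.
Proof.
have := ltn_pmod N (isT : 0 < 4)%N; have := oddN.
rewrite {1}(divn_eq N 4) oddD oddM andbF /=.
by case: (N %% 4)%N => [|[|[|[|]]]] //; [left|right].
Qed.

Lemma etaE1 : (N = 1 %[mod 4])%N -> eta = 1 - i.
Proof.
move=> /sqrtN1_exprVN1 iN; rewrite /eta iN.
by rewrite mulrBr mulrN -expr2 i2 opprK mulr1.
Qed.

Lemma etaE3 : (N = 3 %[mod 4])%N -> eta = -1 - i.
Proof.
move=> /sqrtN1_exprVN3 iN; rewrite /eta iN.
by rewrite mulrBr -expr2 i2 mulr1.
Qed.

Lemma eta_unit : eta \is a GRing.unit.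
Proof.
case: odd_mod4 => N4.
  by rewrite (etaE1 N4) add1_sqrtN1_unit ?two_unit // sqrrN.
by rewrite (etaE3 N4) -opprD unitrN add1_sqrtN1_unit ?two_unit.
Qed.

Lemma H0E1 : (N = 1 %[mod 4])%N -> H 0 = 1.
Proof.
move=> N4; rewrite /H eqxx sqrtN1_exprVN1 // -(etaE1 N4) divrr //.
exact: eta_unit.
Qed.

Lemma H0E3 : (N = 3 %[mod 4])%N -> H 0 = -1.
Proof.
move=> N4; rewrite /H eqxx sqrtN1_exprVN3 //.
have -> : 1 + i = - eta by rewrite etaE3 // -opprD opprK.
by rewrite mulNr divrr //; exact: eta_unit.
Qed.

Lemma H_unit k : H k \is a GRing.unit.
Proof.
case: k => [|k].
  by case: odd_mod4 => N4; rewrite ?(H0E1 N4) ?(H0E3 N4) ?unitrN unitr1.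
have [ui _] := sqrtN1_unit _ _ i2.
by rewrite /H /= !unitrM two_unit unitrV unitrX ?unitrV ?eta_unit.
Qed.

(** Both sides agree after multiplication by the units eta and 1 - v. *)
Lemma euler_updown_expansion :
  hint A euler_updown = \sum_(0 <= k < N) hconst (H k) * heps i ^+ k.
Proof.
have [ui iV] := sqrtN1_unit _ _ i2.
have N_gt0 : (0 < N)%N by case: (N) oddN.
(* The sum of the H k u ^ k is geometric in v = u / i up to its weights. *)
pose v : hurwitz A := hconst i^-1 * heps i.
have vX k : v ^+ k = hconst (i ^- k) * heps i ^+ k.
  by rewrite exprMn -rmorphXn exprVn.
have uN : heps i ^+ N = 1 by rewrite hepsX N0 mul0r heps0.
have unit_1v : 1 - v \is a GRing.unit.
  rewrite unfold_in /= /hunit /=.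
  by rewrite big_ord1 /= bin0 mulr1 iV opprK add1_sqrtN1_unit ?two_unit.
have unit_eta : hconst eta \is a GRing.unit.
  by apply: rmorph_unit; exact: eta_unit.
apply: (mulrI unit_eta); apply: (mulrI unit_1v).
have -> : hconst eta * (\sum_(0 <= k < N) hconst (H k) * heps i ^+ k)
    = 1 + v ^+ N + \sum_(1 <= k < N) 2%:R * v ^+ k.
  have etaH x : hconst eta * hconst (x * eta^-1) = hconst x.
    by rewrite -rmorphM mulrC divrK // eta_unit.
  rewrite mulr_sumr big_ltn // /H eqxx mulrA etaH vX uN !mulr1 rmorphD rmorph1.
  congr (_ + _); apply: eq_big_nat => k /andP[k_gt0 _].
  by rewrite gtn_eqF // mulrA etaH vX mulrA rmorphM rmorph_nat.
rewrite half_geometric_sum // vX uN mulr1.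
have := euler_updown_homography _ _ i2 two_unit.
have -> : 1 + hconst i * heps i = 1 - v by rewrite /v iV rmorphN mulNr opprK.
have -> : heps i + hconst i = hconst i * (1 + v).
  by rewrite mulrDr mulr1 /v mulrA -rmorphM divrr // rmorph1 mul1r addrC.
move=> E.
transitivity (hconst eta * (hint A euler_updown * (1 - v))); first by ring.
rewrite E.
transitivity (hconst (eta * i) * (1 + v)); first by rewrite mulrA -rmorphM.
rewrite mulrC; congr (_ * _).
have -> : eta * i = 1 - i ^- N.
  by rewrite /eta mulrAC -expr2 i2 mulN1r opprB.
by rewrite rmorphB rmorph1.
Qed.

(** Comparing n-th coefficients in the expansion; the hypothesis r >= 1 gives
    n > 0, which removes the term k = 0, where 0 ^ n occurs. *)
Lemma euler_updown_coef (p r n : nat) : (1 <= r)%N -> N = (p ^ r)%N ->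
    (r <= n)%N ->
  (euler_updown n)%:~R
  = \sum_(1 <= k < N | ~~ (p %| k)%N) H k * (k%:R * i) ^+ n.
Proof.
move=> r_gt0 Npr rn.
have N_gt0 : (0 < N)%N by case: (N) oddN.
rewrite -[LHS]/(hint A euler_updown n) euler_updown_expansion.
rewrite hurwitz_coef_sum.
under eq_bigr => k _ do rewrite hconstM_coef hepsX /=.
rewrite big_ltn // mul0r expr0n gtn_eqF ?(leq_trans r_gt0) // mulr0 add0r.
rewrite [RHS]big_mkcond; apply: eq_bigr => k _; case: ifP => // /negbFE pk.
(* p ^ r divides k ^ n because p divides k and r <= n. *)
have /dvdnP[m km] : (N %| k ^ n)%N.
  by rewrite Npr (dvdn_trans (dvdn_exp2l p rn)) // dvdn_exp2r.
by rewrite exprMn -natrX km natrM N0 mulr0 mul0r mulr0.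
Qed.
End Expansion.

(** * Specialization to (Z / p ^ r)[x] / (x ^ 2 + 1) *)

Theorem proposition4p4 (p r : nat) (hp : prime p) (hp2 : odd p) (hr : (1 <= r)%N) :
  let N := (p ^ r)%N in
  let i : gauss_zmod p r := gauss_i p r in
  let u : hurwitz (gauss_zmod p r) := heps i in
  let F : hurwitz (gauss_zmod p r) := [hurwitz n => (euler_updown n)%:~R] in
  let eta : gauss_zmod p r := i * (i ^- N - 1) in
  let H (k : nat) : gauss_zmod p r :=
    if k == 0%N then (1 + i ^- N) * eta^-1 else 2%:R * i ^- k * eta^-1 in
  [/\ [/\ (N = 1 %[mod 4])%N -> eta = 1 - i,
          (N = 3 %[mod 4])%N -> eta = -1 - i
        & eta \is a GRing.unit],
      [/\ (N = 1 %[mod 4])%N -> H 0%N = 1,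
          (N = 3 %[mod 4])%N -> H 0%N = -1
        & forall k : nat, (k <= N - 1)%N -> H k \is a GRing.unit],
      F = \sum_(0 <= k < N) hconst (H k) * u ^+ k
    & forall n : nat, (r <= n)%N ->
        F n = \sum_(1 <= k < N | ~~ (p %| k)%N) H k * (k%:R * i) ^+ n].
Proof.
move=> N i u F eta H.
have i2 : i ^+ 2 = -1 by exact: gauss_i_sqr.
have oddN : odd N by rewrite oddX hp2 orbT.
have N0 : N%:R = 0 :> gauss_zmod p r.
  have N_gt1 : (1 < N)%N by rewrite -(exp1n r) ltn_exp2r // prime_gt1.
  rewrite -(rmorph_nat (in_qpoly ('X^2 + 1 : {poly 'Z_N}))) -polyC_natr.
  by rewrite pchar_Zp // polyC0 rmorph0.
split; last 2 first.
- exact: (euler_updown_expansion _ i).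
- by move=> n; exact: (euler_updown_coef _ i N i2 oddN N0 p r n hr erefl).
- split; [exact: etaE1 | exact: etaE3 | exact: eta_unit].
- split; [exact: H0E1 | exact: H0E3 | by move=> k _; exact: H_unit].
Qed.
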